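(* The lamplighter group $\mathbb{Z}/2\mathbb{Z}\wr\mathbb{Z}$ has a marked quotient algorithm with respect to the set of finite groups.
   Context: A $k$-marked group is a pair $(G,S)$ with $G$ a group and $S=(s_1,\dots,s_k)\in G^k$ a tuple generating $G$. A morphism $(G,S)\to(H,S')$ of $k$-marked groups is a group homomorphism sending $s_i$ to $s_i'$ for each $i$; marked groups are considered up to isomorphism of marked groups. $(H,S')$ is a marked quotient of $(G,S)$ if there is a morphism $(G,S)\to(H,S')$. Recursive presentations: let $\mathcal{A}_n=\{x_1,\dots,x_n\}$, $\theta_n:\mathbb{N}\to(\mathcal{A}_n\cup\mathcal{A}_n^{-1})^*$ a natural computable bijection uniformly in $n\ge1$, $W_i$ the $i$-th computably enumerable subset of $\mathbb{N}$ in a standard enumeration, $\langle\cdot,\cdot\rangle$ a computable pairing bijection, and $\nu_{RP}(\langle n,i\rangle)=\langle\mathcal{A}_n\mid\theta_n(W_i)\rangle$, marked by $(x_1,\dots,x_n)$. Let $\mathcal{C}$ be a class of groups closed under isomorphism. A $k$-marked group $(G,S)$ has a marked quotient algorithm relative to (or with respect to) $\mathcal{C}$ if there is an algorithm that takes as input recursive presentations of marked groups whose underlying group is in $\mathcal{C}$ and stops exactly on those that define marked quotients of $(G,S)$; i.e. there is a partial computable function $F$ such that for every $j$ for which the group $\nu_{RP}(\langle k,j\rangle)$ is in $\mathcal{C}$, $F(j)$ is defined if and only if $\nu_{RP}(\langle k,j\rangle)$ is a marked quotient of $(G,S)$. A finitely generated group has a marked quotient algorithm relative to $\mathcal{C}$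 if it has one with respect to some marking (this does not depend on the marking). *)

(* Defs.v *)
From Stdlib Require Cantor.
From HB Require Import structures.
From mathcomp Require Import all_boot all_order all_algebra.
From mathcomp Require Import generic_quotient finmap.
From mathcomp Require Import boolp classical_sets functions cardinality.

Set Implicit Arguments.
Unset Strict Implicit.
Unset Printing Implicit Defensive.

Import GRing.Theory.
Local Open Scope classical_set_scope.

(* Partial computable functions on nat, by Kleene's schemata in unary form:   *)
(* tuples are passed as numbers through the Cantor pairing bijection.         *)

Definition npair (a b : nat) : nat := Cantor.to_nat (a, b).
Definition nunpair (n : nat) : nat * nat := Cantor.of_nat n.

Lemma npairK a b : nunpair (npair a b) = (a, b).
Proof. exact: Cantor.cancel_of_to. Qed.

Lemma nunpairK n : npair (nunpair n).1 (nunpair n).2 = n.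
Proof.
by rewrite /npair -[RHS]Cantor.cancel_to_of /nunpair; case: Cantor.of_nat.
Qed.

Lemma npair_inj a b c d : npair a b = npair c d -> a = c /\ b = d.
Proof. by move=> /(congr1 nunpair); rewrite !npairK => -[]. Qed.

Inductive code : Type :=
| Zero | Succ | Left | Right
| Pair of code & code
| Comp of code & code
| Prec of code & code
| Mu of code.

Inductive computes : code -> nat -> nat -> Prop :=
| computes_zero x : computes Zero x 0
| computes_succ x : computes Succ x x.+1
| computes_left a b : computes Left (npair a b) a
| computes_right a b : computes Right (npair a b) b
| computes_pair f g x a b :
    computes f x a -> computes g x b -> computes (Pair f g) x (npair a b)
| computes_comp f g x y z :
    computes g x y -> computes f y z -> computes (Comp f g) x z
| computes_prec0 f g a y :
    computes f a y -> computes (Prec f g) (npair a 0) y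
| computes_precS f g a n y z :
    computes (Prec f g) (npair a n) y ->
    computes g (npair a (npair n y)) z ->
    computes (Prec f g) (npair a n.+1) z
(* v lists the predecessors of the (nonzero) values met before the first zero *)
| computes_mu f x n (v : nat -> nat) :
    (forall m, m < n -> computes f (npair x m) (v m).+1) ->
    computes f (npair x n) 0 -> computes (Mu f) x n.

Lemma computes_inv c x y : computes c x y ->
  match c with
  | Zero => y = 0
  | Succ => y = x.+1
  | Left => y = (nunpair x).1
  | Right => y = (nunpair x).2
  | Pair f g => exists a b, [/\ y = npair a b, computes f x a & computes g x b]
  | Comp f g => exists2 z, computes g x z & computes f z y
  | Prec f g => if (nunpair x).2 is n.+1 then
      exists2 z, computes (Prec f g) (npair (nunpair x).1 n) z &
        computes g (npair (nunpair x).1 (npair n z)) y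
      else computes f (nunpair x).1 y
  | Mu f => computes f (npair x y) 0 /\
      forall m, m < y -> exists k, computes f (npair x m) k.+1
  end.
Proof.
case=> {c x y} *; rewrite ?npairK //=; try by do ?econstructor; eauto.
Qed.

Lemma computes_fun c x y z : computes c x y -> computes c x z -> y = z.
Proof.
move=> cxy; move: z; elim: cxy => {c x y}.
- by move=> x z /computes_inv.
- by move=> x z /computes_inv.
- by move=> a b z /computes_inv; rewrite npairK.
- by move=> a b z /computes_inv; rewrite npairK.
- by move=> f g x a b _ IHf _ IHg z /computes_inv[a' [b' [-> /IHf-> /IHg->]]].
- by move=> f g x y w _ IHg _ IHf z /computes_inv[y' /IHg<- /IHf].
- by move=> f g a y _ IHf z /computes_inv; rewrite npairK => /IHf.
- move=> f g a n y w _ IHp _ IHg z /computes_inv; rewrite npairK.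
  by move=> [y' /IHp<- /IHg].
- move=> f x n v _ IHv _ IH0 z /computes_inv[H0 Hv].
  case: (ltngtP n z) => // ltnz; first by have [k /IH0] := Hv _ ltnz.
  by have := IHv _ ltnz _ H0.
Qed.

Definition partial_computable (F : nat -> option nat) : Prop :=
  exists c, forall x y, F x = Some y <-> computes c x y.

Fixpoint godel (c : code) : nat :=
  match c with
  | Zero => 0
  | Succ => 1
  | Left => 2
  | Right => 3
  | Pair f g => 4 + 4 * npair (godel f) (godel g)
  | Comp f g => 5 + 4 * npair (godel f) (godel g)
  | Prec f g => 6 + 4 * npair (godel f) (godel g)
  | Mu f => 7 + 4 * godel f
  end.

Lemma godel_inj : injective godel.
Proof.
have eq4 r s m n : r < 4 -> s < 4 ->
    4 + r + 4 * m = 4 + s + 4 * n -> r = s /\ m = n.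
  move=> r4 s4; rewrite -!addnA => /addnI; rewrite !(mulnC 4) => E; split.
    by have := congr1 (modn^~ 4) E; rewrite /= ![_ + _ * 4]addnC !modnMDl !modn_small.
  have := congr1 (divn^~ 4) E.
  by rewrite /= ![_ + _ * 4]addnC !divnMDl // !divn_small // !addn0.
elim=> [ | | | |f IHf g IHg|f IHf g IHg|f IHf g IHg|f IHf]
  [ | | | |f' g'|f' g'|f' g'|f'] //= E;
  match type of E with ?r + 4 * ?m = ?s + 4 * ?n =>
    case: (@eq4 (r - 4) (s - 4) m n isT isT E) => // _
  end.
- by move=> /npair_inj[/IHf-> /IHg->].
- by move=> /npair_inj[/IHf-> /IHg->].
- by move=> /npair_inj[/IHf-> /IHg->].
- by move=> /IHf->.
Qed.

(* The i-th computably enumerable set is the domain of the program with Godel *)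
(* number i, and is empty if there is none.                                   *)
Definition W (i : nat) : set nat :=
  [set x | exists c, godel c = i /\ exists y, computes c x y].

(* (i, false) stands for the generator x_i and (i, true) for its inverse.     *)
Definition letter (n : nat) : Type := ('I_n * bool)%type.
Notation word n := (seq (letter n)).

HB.instance Definition _ n := Choice.on (letter n).

Definition letter_inv n (l : letter n) : letter n := (l.1, ~~ l.2).

(* The natural bijection between nat and words in n.+1 generators: bijective  *)
(* base-(2n+2) notation, least significant digit first, where the digits      *)
(* 2i+1 and 2i+2 stand for x_i and its inverse.                               *)
Fixpoint theta_rec n (fuel m : nat) : word n.+1 :=
  match fuel, m with
  | fuel'.+1, m'.+1 =>
      let d := m' %% n.+1.*2 in
      (inord d./2, odd d) :: theta_rec n fuel' (m' %/ n.+1.*2)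
  | _, _ => [::]
  end.

Definition theta (n : nat) : nat -> word n :=
  match n with
  | 0 => fun=> [::]
  | n'.+1 => fun m => theta_rec n' m m
  end.

Definition theta_inv (n : nat) (w : word n) : nat :=
  foldr (fun (l : letter n) m => (l.2 + (l.1 : nat).*2 + m * n.*2).+1) 0 w.

Lemma theta_recK n k m : m <= k -> @theta_inv n.+1 (theta_rec n k m) = m.
Proof.
elim: k m => [|k IHk] [|m] //=; rewrite ltnS => le_mk.
rewrite IHk; last exact: leq_trans (leq_div _ _) _.
have d_lt : m %% n.+1.*2 < n.+1.*2 by rewrite ltn_pmod.
congr _.+1; rewrite inordK; last by rewrite ltn_half_double.
by rewrite odd_double_half addnC -divn_eq.
Qed.

Lemma thetaK n : cancel (@theta n.+1) (@theta_inv n.+1).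
Proof. by move=> m; exact: theta_recK. Qed.

Lemma theta_rec_invK n k (w : word n.+1) :
  theta_inv w <= k -> theta_rec n k (theta_inv w) = w.
Proof.
elim: k w => [|k IHk] [|[i b] w] //=; rewrite ltnS => le_k.
have d_lt : b + i.*2 < n.+1.*2.
  have: i.*2.+1 < n.+1.*2 by rewrite ltn_Sdouble ltn_ord.
  by apply: leq_ltn_trans; case: b {le_k}; rewrite ?leqnSn.
rewrite addnC modnMDl modn_small // divnMDl // divn_small // addn0.
rewrite half_bit_double oddD odd_double addbF oddb inord_val IHk //.
by apply: leq_trans le_k; rewrite addnC (leq_trans _ (leq_addr _ _)) // leq_pmulr.
Qed.

Lemma theta_invK n : cancel (@theta_inv n.+1) (@theta n.+1).
Proof. by move=> w; exact: theta_rec_invK. Qed.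

Section WordEval.
Local Open Scope group_scope.
Variable G : groupType.

Definition letter_eval n (S : 'I_n -> G) (l : letter n) : G :=
  if l.2 then (S l.1)^-1 else S l.1.

Definition word_eval n (S : 'I_n -> G) (w : word n) : G :=
  \prod_(l <- w) letter_eval S l.

Definition generates n (S : 'I_n -> G) : Prop :=
  forall g : G, exists w : word n, word_eval S w = g.

End WordEval.

Record markedGroup (k : nat) := MarkedGroup {
  mgroup :> groupType;
  mark : 'I_k -> mgroup;
  mark_generates : generates mark
}.

Definition marked_morphism k (G H : markedGroup k)
    (f : {multiplicative G -> H}) : Prop :=
  forall i, f (mark G i) = mark H i.

Definition marked_quotient k (G H : markedGroup k) : Prop :=
  exists f : {multiplicative G -> H}, marked_morphism f.

Inductive pres_eq n (R : set (word n)) : word n -> word n -> Prop :=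
| pres_refl w : pres_eq R w w
| pres_sym v w : pres_eq R v w -> pres_eq R w v
| pres_trans u v w : pres_eq R u v -> pres_eq R v w -> pres_eq R u w
| pres_cancel u v l : pres_eq R (u ++ l :: letter_inv l :: v) (u ++ v)
| pres_relator u v r : R r -> pres_eq R (u ++ r ++ v) (u ++ v).

(* Words modulo pres_eq R form the group presented by the relators R.         *)
Section Presented.
Variables (n : nat) (R : set (word n)).

Definition pres_eqb : rel (word n) := fun v w => `[< pres_eq R v w >].

Lemma pres_eqb_refl : reflexive pres_eqb.
Proof. by move=> w; apply/asboolP/pres_refl. Qed.

Lemma pres_eqb_sym : symmetric pres_eqb.
Proof. by move=> v w; apply/asboolP/asboolP => /pres_sym. Qed.

Lemma pres_eqb_trans : transitive pres_eqb.
Proof.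
by move=> v u w /asboolP uv /asboolP vw; apply/asboolP/(pres_trans uv vw).
Qed.

Canonical pres_equiv := EquivRel pres_eqb
  pres_eqb_refl pres_eqb_sym pres_eqb_trans.

Definition presented : Type := {eq_quot pres_eqb}%qT.
HB.instance Definition _ := Choice.on presented.

Definition pres_class (w : word n) : presented := (\pi_{eq_quot pres_eqb} w)%qT.

Lemma pres_classP v w : pres_class v = pres_class w <-> pres_eq R v w.
Proof. by split=> [/eqmodP/asboolP|vw] //; apply/eqmodP/asboolP. Qed.

Definition pres_repr (x : presented) : word n := repr (x : {eq_quot pres_eqb}%qT).

Lemma pres_reprK : cancel pres_repr pres_class.
Proof. by move=> x; rewrite /pres_class /pres_repr reprK. Qed.

Lemma pres_eq_catl u v w : pres_eq R v w -> pres_eq R (u ++ v) (u ++ w).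
Proof.
elim=> {v w} [w|v w _|v w x _ vw _|v w l|v w r Rr]; first exact: pres_refl.
- exact: pres_sym.
- exact: pres_trans.
- by rewrite !catA; exact: pres_cancel.
- by rewrite (catA u v (r ++ w)) (catA u v w); exact: pres_relator.
Qed.

Lemma pres_eq_catr u v w : pres_eq R v w -> pres_eq R (v ++ u) (w ++ u).
Proof.
elim=> {v w} [w|v w _|v w x _ vw _|v w l|v w r Rr]; first exact: pres_refl.
- exact: pres_sym.
- exact: pres_trans.
- by rewrite -!catA; exact: pres_cancel.
- by rewrite -!catA; exact: pres_relator.
Qed.

Definition word_inv (w : word n) : word n := rev (map (@letter_inv n) w).

Lemma letter_invK : involutive (@letter_inv n).
Proof. by case=> i b; rewrite /letter_inv /= negbK. Qed.

Lemma word_inv_cat v w : word_inv (v ++ w) = word_inv w ++ word_inv v.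
Proof. by rewrite /word_inv map_cat rev_cat. Qed.

Lemma word_invK : involutive word_inv.
Proof. by move=> w; rewrite /word_inv map_rev revK mapK //; exact: letter_invK. Qed.

Lemma pres_mulVw w : pres_eq R (word_inv w ++ w) [::].
Proof.
elim: w => [|l w IHw]; first exact: pres_refl.
rewrite /word_inv /= rev_cons -/(word_inv w) cat_rcons.
by apply: pres_trans IHw; rewrite -{2}[l]letter_invK; exact: pres_cancel.
Qed.

Lemma pres_mulwV w : pres_eq R (w ++ word_inv w) [::].
Proof. by rewrite -{1}[w]word_invK; exact: pres_mulVw. Qed.

Definition pres_one : presented := pres_class [::].
Definition pres_mul (x y : presented) : presented :=
  pres_class (pres_repr x ++ pres_repr y).
Definition pres_inv (x : presented) : presented :=
  pres_class (word_inv (pres_repr x)).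

Lemma pres_class_cat v w :
  pres_class (v ++ w) = pres_mul (pres_class v) (pres_class w).
Proof.
apply/pres_classP/(@pres_trans _ _ _ (pres_repr (pres_class v) ++ w)).
  by apply/pres_eq_catr/pres_classP; rewrite pres_reprK.
by apply/pres_eq_catl/pres_classP; rewrite pres_reprK.
Qed.

Lemma pres_mulA : associative pres_mul.
Proof.
move=> x y z; rewrite -(pres_reprK x) -(pres_reprK y) -(pres_reprK z).
by rewrite -!pres_class_cat catA.
Qed.

Lemma pres_mul1x : left_id pres_one pres_mul.
Proof. by move=> x; rewrite -(pres_reprK x) -pres_class_cat. Qed.

Lemma pres_mulx1 : right_id pres_one pres_mul.
Proof. by move=> x; rewrite -(pres_reprK x) -pres_class_cat cats0. Qed.

Lemma pres_mulVx : left_inverse pres_one pres_inv pres_mul.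
Proof.
move=> x; rewrite -{2}(pres_reprK x) -pres_class_cat.
exact/pres_classP/pres_mulVw.
Qed.

Lemma pres_mulxV : right_inverse pres_one pres_inv pres_mul.
Proof.
move=> x; rewrite -{1}(pres_reprK x) -pres_class_cat.
exact/pres_classP/pres_mulwV.
Qed.

HB.instance Definition _ := isGroup.Build presented
  pres_mulA pres_mul1x pres_mulx1 pres_mulVx pres_mulxV.

Definition pres_gen (i : 'I_n) : presented := pres_class [:: (i, false)].

Lemma pres_word_eval w : word_eval pres_gen w = pres_class w.
Proof.
elim: w => [|l w IHw]; first by rewrite /word_eval big_nil.
rewrite /word_eval big_cons -/(word_eval _ _) IHw -cat1s pres_class_cat.
congr pres_mul; rewrite /letter_eval; case: l => i [] //=.
apply/pres_classP; rewrite -[X in pres_eq _ _ X]/(word_inv [:: (i, false)]).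
have := pres_reprK (pres_gen i) => /pres_classP E.
apply: (@pres_trans _ _ _ (word_inv (pres_repr (pres_gen i))
    ++ [:: (i, false)] ++ word_inv [:: (i, false)])).
  apply: pres_sym; rewrite -[X in pres_eq _ _ X]cats0.
  exact/pres_eq_catl/pres_mulwV.
rewrite catA -[X in pres_eq _ _ X]cat0s; apply/pres_eq_catr.
apply: pres_trans (pres_mulVw (pres_repr (pres_gen i))).
exact/pres_eq_catl/pres_sym.
Qed.

Lemma pres_generates : generates pres_gen.
Proof. by move=> x; exists (pres_repr x); rewrite pres_word_eval pres_reprK. Qed.

Definition presented_marked : markedGroup n := MarkedGroup pres_generates.

End Presented.

(* Curried: nuRP n i is the recursive presentation with code npair n i.        *)
Definition nuRP (n i : nat) : markedGroup n :=
  presented_marked (@theta n @` W i).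

Definition has_marked_quotient_algorithm (C : groupType -> Prop) k
    (G : markedGroup k) : Prop :=
  exists F : nat -> option nat, partial_computable F /\
    forall j : nat, C (nuRP k j) ->
      (isSome (F j) <-> marked_quotient G (nuRP k j)).

Definition group_has_marked_quotient_algorithm (C : groupType -> Prop)
    (G : groupType) : Prop :=
  exists k (S : 'I_k -> G) (genS : generates S),
    has_marked_quotient_algorithm C (MarkedGroup genS).

Definition finite_group (G : groupType) : Prop := finite_set [set: G].

(* The additive group of V, written multiplicatively.                         *)
Definition mult_group (V : zmodType) : Type := V.

Section MultGroup.
Variable V : zmodType.
HB.instance Definition _ := Choice.on (mult_group V).
HB.instance Definition _ := isGroup.Build (mult_group V)
  (@addrA V) (@add0r V) (@addr0 V) (@addNr V) (@addrN V).
End MultGroup.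

Section Wreath.
Local Open Scope group_scope.
Variables A B : groupType.

(* Pairs of a finitely supported function from B to A and an element of B.    *)
Definition wreath : Type := ({fsfun B -> A with 1} * B)%type.
HB.instance Definition _ := Choice.on wreath.

Definition fsfun_shift (b : B) (f : {fsfun B -> A with 1}) :
    {fsfun B -> A with 1} :=
  [fsfun x in ((fun y => b * y) @` finsupp f)%fset => f (b^-1 * x) | 1].

Definition fsfun_mul (f g : {fsfun B -> A with 1}) : {fsfun B -> A with 1} :=
  [fsfun x in (finsupp f `|` finsupp g)%fset => f x * g x | 1].

Definition fsfun_inv (f : {fsfun B -> A with 1}) : {fsfun B -> A with 1} :=
  [fsfun x in finsupp f => (f x)^-1 | 1].

Lemma fsfun_shiftE b f x : fsfun_shift b f x = f (b^-1 * x).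
Proof.
rewrite fsfunE; case: ifPn => // nx; apply/esym/fsfun_dflt.
apply: contra nx => xf; apply/imfsetP => /=.
by exists (b^-1 * x); rewrite ?mulVKg.
Qed.

Lemma fsfun_mulE f g x : fsfun_mul f g x = f x * g x.
Proof.
rewrite fsfunE in_fsetU; case: ifPn => //; rewrite negb_or => /andP[xf xg].
by rewrite !fsfun_dflt // mulg1.
Qed.

Lemma fsfun_invE f x : fsfun_inv f x = (f x)^-1.
Proof.
by rewrite fsfunE; case: ifPn => // xf; rewrite fsfun_dflt // invg1.
Qed.

(* (f, b) (g, c) = (f (b . g), b c), where (b . g)(x) = g (b^-1 x).           *)
Definition wreath_one : wreath := ([fsfun with 1], 1).
Definition wreath_mul (x y : wreath) : wreath :=
  (fsfun_mul x.1 (fsfun_shift x.2 y.1), x.2 * y.2).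
Definition wreath_inv (x : wreath) : wreath :=
  (fsfun_shift x.2^-1 (fsfun_inv x.1), x.2^-1).

Let fE := (fsfun_mulE, fsfun_shiftE, fsfun_invE, @fsfun0E).

Lemma wreath_mulA : associative wreath_mul.
Proof.
case=> f a [g b] [h c]; congr pair => /=; last exact: mulgA.
by apply/fsfunP => x; rewrite !fE invgM !mulgA.
Qed.

Lemma wreath_mul1x : left_id wreath_one wreath_mul.
Proof.
case=> f a; congr pair => /=; last exact: mul1g.
by apply/fsfunP => x; rewrite !fE invg1 !mul1g.
Qed.

Lemma wreath_mulx1 : right_id wreath_one wreath_mul.
Proof.
case=> f a; congr pair => /=; last exact: mulg1.
by apply/fsfunP => x; rewrite !fE mulg1.
Qed.

Lemma wreath_mulVx : left_inverse wreath_one wreath_inv wreath_mul.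
Proof.
case=> f a; congr pair => /=; last exact: mulVg.
by apply/fsfunP => x; rewrite !fE mulVg.
Qed.

Lemma wreath_mulxV : right_inverse wreath_one wreath_inv wreath_mul.
Proof.
case=> f a; congr pair => /=; last exact: mulgV.
by apply/fsfunP => x; rewrite !fE invgK mulVKg mulgV.
Qed.

HB.instance Definition _ := isGroup.Build wreath
  wreath_mulA wreath_mul1x wreath_mulx1 wreath_mulVx wreath_mulxV.

End Wreath.

Definition lamplighter : groupType := wreath (mult_group 'Z_2) (mult_group int).

(* Main.v *)
(* A pair (a, t) in a group H is the image of the standard generators of the  *)
(* lamplighter group iff a^2 = 1 and a commutes with every t^k a t^-k. If t   *)
(* has finite order n this is a finite set of relations, k < n being enough,  *)
(* and the algorithm looks for consequences of the relators of H of the form  *)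
(* t^n = 1, a^2 = 1 and t^k a t^-k a = a t^k a t^-k for all k < n. On finite  *)
(* quotients of the lamplighter group the search succeeds since t has finite  *)
(* order. It is a Mu search because running the programs that enumerate the   *)
(* relators, and deriving equations from these relators, are both inductively *)
(* generated by finitely many computable rules with at most two premises.     *)

Require Import Defs.
From HB Require Import structures.
From mathcomp Require Import all_boot all_order all_algebra.
From mathcomp Require Import generic_quotient finmap.
From mathcomp Require Import boolp classical_sets functions cardinality.

Set Implicit Arguments.
Unset Strict Implicit.
Unset Printing Implicit Defensive.

Import GRing.Theory.

(** * Computable functions *)

(** With a, t the marked generators of H, being a marked quotient of the lamplighter group means
    infinitely many equations: a^2 = 1, and a commutes with every t^k a t^-k
    ([lamplighter_quotientP]). If t^(n+1) = 1, conjugation by t^k depends only on k modulo n+1, so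
    finitely many of them imply the rest ([commute_cyclic]). In a finite group such an n exists by
    pigeonhole ([finite_group_exponent]), hence [nuRP_quotientP]: a finite H is a quotient iff, for
    some n, finitely many equations between words hold in H.

    Equality of words in a recursively presented group is semidecidable, so one can search for n
    together with proofs of these equations. To get an actual program, running programs, deriving
    equations and assembling the final claim are all put into one system [rules]. Anything derivable
    by computable rules with at most two premises can be found by unbounded search
    ([derivable_semidecidable]). The system proves only true judgements ([rules_sound]) and proves
    the claim whenever it is true ([provable_quotient]). *)

Definition computable (f : nat -> nat) : Prop :=
  exists c, forall x, computes c x (f x).

Lemma computable_id : computable id.
Proof.
exists (Pair Left Right) => x; rewrite -[x in computes _ x _]nunpairK.
by rewrite -[x in computes _ _ x]nunpairK; constructor; constructor.
Qed.

Lemma computable_const n : computable (fun=> n).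
Proof.
elim: n => [|n [c Hc]]; first by exists Zero; constructor.
by exists (Comp Succ c) => x; econstructor; [exact: Hc|constructor].
Qed.

Lemma computable_comp g f :
  computable g -> computable f -> computable (fun x => g (f x)).
Proof.
by move=> [d Hd] [c Hc]; exists (Comp d c) => x; econstructor; [exact: Hc|].
Qed.

Lemma computable_succ f : computable f -> computable (fun x => (f x).+1).
Proof.
by apply: (@computable_comp S); exists Succ; constructor.
Qed.

Lemma computable_fst f :
  computable f -> computable (fun x => (nunpair (f x)).1).
Proof.
apply: (@computable_comp (fun x => (nunpair x).1)); exists Left => x.
by rewrite -[x in computes _ x _]nunpairK; constructor.
Qed.

Lemma computable_snd f :
  computable f -> computable (fun x => (nunpair (f x)).2).
Proof.
apply: (@computable_comp (fun x => (nunpair x).2)); exists Right => x.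
by rewrite -[x in computes _ x _]nunpairK; constructor.
Qed.

Lemma computable_pair f g :
  computable f -> computable g -> computable (fun x => npair (f x) (g x)).
Proof. by move=> [c Hc] [d Hd]; exists (Pair c d) => x; constructor. Qed.

Lemma computable_prec f g a n :
  computable f -> computable g -> computable a -> computable n ->
  computable (fun x =>
    iteri (n x) (fun k y => g (npair (a x) (npair k y))) (f (a x))).
Proof.
move=> [cf Hf] [cg Hg] Ca Cn; have [e He] := computable_pair Ca Cn.
exists (Comp (Prec cf cg) e) => x; apply: computes_comp (He x) _.
elim: (n x) => [|k IHk] /=; first by constructor.
by econstructor; [exact: IHk|].
Qed.

Lemma computable_iter g a n : computable g -> computable a -> computable n ->
  computable (fun x => iter (n x) g (a x)).
Proof.
move=> Cg Ca Cn; have C := computable_comp Cg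
  (computable_snd (computable_snd computable_id)).
have := computable_prec computable_id C Ca Cn; congr computable.
apply/funext => x; elim: (n x) => //= k ->.
by rewrite !npairK.
Qed.

Lemma computable_add f g :
  computable f -> computable g -> computable (fun x => f x + g x).
Proof.
move=> Cf Cg; have := computable_iter (computable_succ computable_id) Cf Cg.
by congr computable; apply/funext => x; rewrite iter_succn.
Qed.

Lemma computable_pred f : computable f -> computable (fun x => (f x).-1).
Proof.
move=> Cf; have := computable_prec computable_id
  (computable_fst (computable_snd computable_id)) (computable_const 0) Cf.
by congr computable; apply/funext => x; case: (f x) => //= n; rewrite !npairK.
Qed.

Lemma computable_sub f g :
  computable f -> computable g -> computable (fun x => f x - g x).
Proof.
move=> Cf Cg; have := computable_iter (computable_pred computable_id) Cf Cg.
by congr computable; apply/funext => x; rewrite iter_predn.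
Qed.

Lemma computable_mulnr k f : computable f -> computable (fun x => f x * k).
Proof.
move=> Cf; elim: k => [|k IHk].
  have := computable_const 0; congr computable.
  by apply/funext => x; rewrite muln0.
have := computable_add Cf IHk.
by congr computable; apply/funext => x; rewrite mulnS.
Qed.

(** Definition by cases is a primitive recursion on t x whose step ignores the previous value; the
    parameter carries both branches. *)
Lemma computable_if t f g : computable t -> computable f -> computable g ->
  computable (fun x => if t x == 0 then f x else g x).
Proof.
move=> Ct Cf Cg; have := computable_prec (computable_fst computable_id)
  (computable_snd (computable_fst computable_id)) (computable_pair Cf Cg) Ct.
congr computable; apply/funext => x.
by case: (t x) => [|k] /=; rewrite ?npairK /= ?npairK.
Qed.

Ltac computability := repeat first
  [ assumption
  | lazymatch goal with
    | |- computable (fun _ => ?c) => exact (computable_const c)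
    | |- computable (fun x => x) => exact computable_id
    | |- computable (fun x => npair _ _) => apply: computable_pair
    | |- computable (fun x => S _) => apply: computable_succ
    | |- computable (fun x => fst (nunpair _)) => apply: computable_fst
    | |- computable (fun x => snd (nunpair _)) => apply: computable_snd
    | |- computable (fun x => addn _ _) => apply: computable_add
    | |- computable (fun x => subn _ _) => apply: computable_sub
    | |- computable (fun x => muln _ _) => apply: computable_mulnr
    | |- computable (fun x => iter _ _ _) => apply: computable_iter
    | |- computable (fun x => if _ == 0 then _ else _) => apply: computable_if
    end ].

Lemma computable_nth (F : seq (nat -> nat)) d :
  (forall i, computable (nth d F i)) ->
  computable (fun x => nth d F (nunpair x).1 (nunpair x).2).
Proof.
have sndC : computable (fun x => (nunpair x).2) by computability.
(* The index becomes an arbitrary computable t because the induction on F passes to its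
   predecessor. *)
move=> CF; suff C t : computable t ->
    computable (fun x => nth d F (t x) (nunpair x).2).
  by apply: C; computability.
elim: F CF t => [|f F IHF] CF t Ct.
  have := computable_comp (CF 0) sndC; congr computable.
  by apply/funext => x; rewrite !nth_nil.
have := computable_if Ct (computable_comp (CF 0) sndC)
  (IHF (fun i => CF i.+1) _ (computable_pred Ct)).
by congr computable; apply/funext => x; case: (t x).
Qed.

(** * Sets generated by computable rules *)

Lemma leq_npairl a b : a <= npair a b.
Proof.
by apply: leq_trans (leq_addl b _) _; apply/leP/Cantor.to_nat_non_decreasing.
Qed.

Lemma leq_npairr a b : b <= npair a b.
Proof.
by apply: leq_trans (leq_addr a _) _; apply/leP/Cantor.to_nat_non_decreasing.
Qed.

Inductive derivable (c p q : nat -> nat) : nat -> Prop :=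
| derivable0 : derivable c p q 0
| derivable_step h : derivable c p q (p h) -> derivable c p q (q h) ->
    derivable c p q (c h).

(* Stage n = <h, <i, j>> tries the rule instance h, looking for its premises  *)
(* among the conclusions of the stages i - 1 and j - 1; the conclusions found *)
(* so far are stored in an infinite list, latest first, whose tail is 0.      *)
Section Saturation.
Variables c p q : nat -> nat.

Definition entry (s i : nat) : nat :=
  (nunpair (iter i (fun y => (nunpair y).2) s)).1.

Definition stage (n s : nat) : nat :=
  let: h := (nunpair n).1 in
  let: ij := (nunpair n).2 in
  let: a := entry s (n - (nunpair ij).1) in
  let: b := entry s (n - (nunpair ij).2) in
  if (a - p h) + (p h - a) + ((b - q h) + (q h - b)) == 0 then c h else 0.

Definition stages (n : nat) : nat :=
  iteri n (fun k s => npair (stage k s) s) 0.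

Lemma entry_cons a s i : entry (npair a s) i.+1 = entry s i.
Proof. by rewrite /entry iterSr npairK. Qed.

(** The list is kept latest first, so the result of stage k sits at n - k.+1, at a fixed distance
    from the end. *)
Lemma stages_entry n k :
  k < n -> entry (stages n) (n - k.+1) = stage k (stages k).
Proof.
elim: n => // n IHn; rewrite ltnS leq_eqVlt subSS => /predU1P[->|lt_kn].
  by rewrite subnn /entry /= npairK.
by rewrite -(subnSK lt_kn) /= entry_cons IHn.
Qed.

Lemma distn_eq0 a b : (a - b + (b - a) == 0) = (a == b).
Proof. by rewrite addn_eq0 !subn_eq0 eqn_leq. Qed.

(** Failed stages record 0 and reading past the list gives 0; both are harmless since 0 is
    derivable. *)
Lemma stages_sound n i : derivable c p q (entry (stages n) i).
Proof.
elim: n i => [|n IHn] i.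
  have -> : entry (stages 0) i = 0; last exact: derivable0.
  rewrite /entry.
  suff -> : iter i (fun y => (nunpair y).2) (stages 0) = 0 by [].
  by elim: i => //= i ->.
case: i => [|i] /=; last by rewrite entry_cons.
rewrite /entry /= npairK /stage addn_eq0 !distn_eq0.
case: ifP => [/andP[/eqP P /eqP Q]|_]; last exact: derivable0.
by apply: derivable_step; rewrite -?P -?Q.
Qed.

Lemma entry_end n : entry (stages n) n = 0.
Proof. by elim: n => //= n IHn; rewrite entry_cons. Qed.

(** Indices count from the end of the list, so they stay valid as it grows; index 0 is the tail 0.
    Pairing dominates its components, so stage <h, <i, j>> comes late enough for both premises to be
    present. *)
Lemma stages_complete x : derivable c p q x ->
  exists i, forall n, i <= n -> entry (stages n) (n - i) = x.
Proof.
elim=> [|h _ [i Hi] _ [j Hj]].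
  by exists 0 => n _; rewrite subn0 entry_end.
pose n := npair h (npair i j); exists n.+1 => m lt_nm; rewrite stages_entry //.
have le_in : i <= n by apply: leq_trans (leq_npairr _ _); exact: leq_npairl.
have le_jn : j <= n by apply: leq_trans (leq_npairr _ _); exact: leq_npairr.
rewrite /stage [nunpair n]npairK /= npairK /= Hi // Hj //.
by rewrite addn_eq0 !distn_eq0 !eqxx.
Qed.

End Saturation.

Lemma derivable_semidecidable c p q g : computable c -> computable p ->
  computable q -> computable g ->
  exists e, forall x, (exists y, computes e x y) <-> derivable c p q (g x).
Proof.
move=> Cc Cp Cq Cg.
have Centry f i : computable f -> computable i ->
    computable (fun x => entry (f x) (i x)).
  move=> Cf Ci; apply: computable_fst; apply: computable_iter => //.
  by apply: computable_snd; exact: computable_id.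
have Cstages f : computable f -> computable (fun x => stages c p q (f x)).
  move=> Cf; pose G z := let k := (nunpair (nunpair z).2).1 in
    let s := (nunpair (nunpair z).2).2 in npair (stage c p q k s) s.
  have CG : computable G.
    rewrite /G /stage; do ![apply: Centry | apply: (computable_comp Cc)
      | apply: (computable_comp Cp) | apply: (computable_comp Cq)
      | progress computability].
  have := computable_prec (computable_const 0) CG (computable_const 0) Cf.
  congr computable; apply/funext => x; rewrite /stages.
  by elim: (f x) => //= n ->; rewrite /G !npairK.
(* For z = <x, <n, i>>, t vanishes iff entry i after n stages is g x; [Mu] searches for such a pair
   <n, i>. *)
pose t z := let a := entry (stages c p q (nunpair (nunpair z).2).1)
                      (nunpair (nunpair z).2).2 in
  (a - g (nunpair z).1) + (g (nunpair z).1 - a).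
have [e He] : computable t.
  by rewrite /t; do ![apply: Centry | apply: Cstages
    | apply: (computable_comp Cg) | progress computability].
have {}He z y : computes e z y <-> t z = y.
  by split=> [/computes_fun/(_ (He z))|<-].
exists (Mu e) => x; split=> [[y /computes_inv[/He + _]]|/stages_complete[i Hi]].
  move/eqP; rewrite /t npairK /= distn_eq0 => /eqP <-; exact: stages_sound.
have ex0 : exists n, t (npair x n) == 0.
  (* After exactly i stages the wanted entry is at position i - i = 0. *)
  exists (npair i 0); rewrite /t !npairK distn_eq0.
  by rewrite -[0](subnn i) Hi.
exists (ex_minn ex0); case: ex_minnP => n /eqP tn0 n_min.
apply: (@computes_mu _ _ _ (fun m => (t (npair x m)).-1)); last exact/He.
move=> m lt_mn; apply/He; rewrite prednK // lt0n.
by apply/negP => /n_min; rewrite leqNgt lt_mn.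
Qed.

Lemma code_partial_computable e : exists2 F, partial_computable F &
  forall x, isSome (F x) <-> exists y, computes e x y.
Proof.
pose F x := match pselect (exists y, computes e x y) with
  | left ex => Some (projT1 (cid ex)) | right _ => None end.
have FE x y : F x = Some y <-> computes e x y.
  rewrite /F; case: pselect => [ex|nex]; last first.
    by split=> // exy; case: nex; exists y.
  case: (cid ex) => /= z exz; split=> [[<-] //|exy].
  by rewrite (computes_fun exz exy).
exists F; first by exists e.
move=> x; case Fx: (F x) => [y|]; split=> //.
  by move=> _; exists y; apply/FE.
by move=> [y /FE]; rewrite Fx.
Qed.

(** * Finite systems of rules on encoded sequences *)

Definition encode : seq nat -> nat := foldr npair 0.

Lemma entry_encode s : entry (encode s) = nth 0 s.
Proof.
apply/funext => i; elim: i s => [|i IHi] [|a s] //.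
  by rewrite /entry /= npairK.
  by rewrite [RHS]nth_nil -[RHS](nth_nil _ i) -IHi /entry iterSr.
by rewrite entry_cons IHi.
Qed.

(* A rule maps its parameters to the list of its conclusion and its (at most  *)
(* two) premises. Judgements are read through their entries, since encode is  *)
(* only injective up to trailing zeros; encode [::] = 0 is always derivable.  *)
Definition rule : Type := (nat -> nat) -> seq (seq nat).

Definition rule_code (r : rule) (x : nat) : nat :=
  encode [seq encode s | s <- r (entry x)].

(** The default for indices out of range; its conclusion reads as [encode [::]], which is derivable
    anyway. *)
Definition no_rule : rule := fun=> [::].

Section RuleSystem.
Variable rs : seq rule.

Definition instance (x : nat) : nat :=
  rule_code (nth no_rule rs (nunpair x).1) (nunpair x).2.

Definition provable : nat -> Prop :=
  derivable (fun x => entry (instance x) 0) (fun x => entry (instance x) 1)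
    (fun x => entry (instance x) 2).

Lemma provable_rule i s : let: r := nth no_rule rs i (nth 0 s) in
  provable (encode (nth [::] r 1)) -> provable (encode (nth [::] r 2)) ->
  provable (encode (nth [::] r 0)).
Proof.
have E k : encode (nth [::] (nth no_rule rs i (nth 0 s)) k) =
    entry (instance (npair i (encode s))) k.
  rewrite /instance npairK /rule_code /= entry_encode entry_encode.
  case: (ltnP k (size (nth no_rule rs i (nth 0 s)))) => lt_k.
    by rewrite (nth_map [::]).
  by rewrite nth_default // nth_default ?size_map.
by rewrite !E; apply: derivable_step.
Qed.

Lemma provable_ind_rule (M : (nat -> nat) -> Prop) : M (nth 0 [::]) ->
  (forall i a, let: r := nth no_rule rs i a in
    M (nth 0 (nth [::] r 1)) -> M (nth 0 (nth [::] r 2)) ->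
    M (nth 0 (nth [::] r 0))) ->
  forall s, provable (encode s) -> M (nth 0 s).
Proof.
move=> M0 Mr s; rewrite -entry_encode; elim=> [|x _ + _].
  by rewrite (entry_encode [::]).
have E k : entry (entry (instance x) k) = nth 0 (nth [::]
    (nth no_rule rs (nunpair x).1 (entry (nunpair x).2)) k).
  rewrite /instance /rule_code entry_encode.
  set r := nth no_rule _ _ _; case: (ltnP k (size r)) => lt_k.
    by rewrite (nth_map [::]) // entry_encode.
  by rewrite nth_default ?size_map // [nth [::] r k]nth_default //
    (entry_encode [::]).
by rewrite !E; exact: Mr.
Qed.

Lemma provable_semidecidable g :
  (forall i, computable (rule_code (nth no_rule rs i))) -> computable g ->
  exists e, forall x, (exists y, computes e x y) <-> provable (g x).
Proof.
move=> Crs Cg; have Cinst : computable instance.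
  have := @computable_nth (map rule_code rs) (rule_code no_rule).
  have E i : nth (rule_code no_rule) (map rule_code rs) i =
      rule_code (nth no_rule rs i).
    case: (ltnP i (size rs)) => lt_i; first by rewrite (nth_map no_rule).
    rewrite [RHS](congr1 rule_code (nth_default _ lt_i)).
    by rewrite nth_default ?size_map.
  have -> : (fun x => nth (rule_code no_rule) (map rule_code rs) (nunpair x).1
      (nunpair x).2) = instance by apply/funext => x; rewrite E.
  by apply=> i; rewrite E.
have Centry i : computable (fun x => entry (instance x) i).
  rewrite /entry; apply: computable_fst; elim: i => [|i IHi] //=.
  by apply: computable_snd.
exact: derivable_semidecidable.
Qed.

End RuleSystem.

(** * Consequences of the relators *)

(* The letter (i, b) of a two-letter alphabet has digit 2i + b; numbers stand *)
(* for the words that they enumerate.                                         *)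
Definition digit (l : letter 2) : nat := l.2 + (l.1 : nat).*2.
Definition ncons (d w : nat) : nat := (d + w * 4).+1.

Definition gena : letter 2 := (@Ordinal 2 0 isT, false).
Definition gent : letter 2 := (@Ordinal 2 1 isT, false).

(** The two sides of the relation saying that t^k a t^-k commutes with a. *)
Definition word_ta (k : nat) : seq (letter 2) :=
  nseq k gent ++ gena :: nseq k (letter_inv gent) ++ [:: gena].
Definition word_at (k : nat) : seq (letter 2) :=
  gena :: nseq k gent ++ gena :: nseq k (letter_inv gent).

(** Written as iterations of [ncons] so that computability in k is visible. *)
Definition num_ta (k : nat) : nat :=
  iter k (ncons 2) (ncons 0 (iter k (ncons 3) (ncons 0 0))).
Definition num_at (k : nat) : nat :=
  ncons 0 (iter k (ncons 2) (ncons 0 (iter k (ncons 3) 0))).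

Fact word_of_key : unit. Proof. exact: tt. Qed.
(* Locked because simplification would unfold theta on open successors. *)
Definition word_of : nat -> seq (letter 2) := locked_with word_of_key (theta 2).

Lemma word_ofE : word_of = theta 2.
Proof. exact: unlock. Qed.

Lemma word_ofK : cancel word_of (@theta_inv 2).
Proof. by rewrite word_ofE; exact: thetaK. Qed.

Lemma theta_inv_wordK : cancel (@theta_inv 2) word_of.
Proof. by rewrite word_ofE; exact: theta_invK. Qed.

Lemma theta_inv_cons l (w : seq (letter 2)) :
  theta_inv (l :: w) = ncons (digit l) (theta_inv w).
Proof. by []. Qed.

Lemma theta_inv_nseq k l (w : seq (letter 2)) :
  theta_inv (nseq k l ++ w) = iter k (ncons (digit l)) (theta_inv w).
Proof. by elim: k => //= k <-. Qed.

Lemma word_of0 : word_of 0 = [::].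
Proof. exact: (theta_inv_wordK [::]). Qed.

Lemma word_of_ncons l w : word_of (ncons (digit l) w) = l :: word_of w.
Proof. by rewrite -{1}[w]word_ofK -theta_inv_cons theta_inv_wordK. Qed.

Lemma word_of_iter k l w :
  word_of (iter k (ncons (digit l)) w) = nseq k l ++ word_of w.
Proof. by elim: k => //= k <-; rewrite word_of_ncons. Qed.

Lemma word_of_ta k : word_of (num_ta k) = word_ta k.
Proof.
by rewrite (word_of_iter k gent) (word_of_ncons gena)
  (word_of_iter k (letter_inv gent)) (word_of_ncons gena) word_of0.
Qed.

Lemma word_of_at k : word_of (num_at k) = word_at k.
Proof.
by rewrite (word_of_ncons gena) (word_of_iter k gent) (word_of_ncons gena)
  (word_of_iter k (letter_inv gent)) word_of0 cats0.
Qed.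

(** Soundness uses this to read the number variables of the evaluation rules as programs. From 4 on,
    the residue modulo 4 gives the constructor and the quotient codes its arguments. *)
Lemma godel_surj n : exists c, godel c = n.
Proof.
have [m] := ubnP n; elim: m n => // m IHm n.
case: (ltnP n 4) => [|n4].
  by case: n => [|[|[|[|]]]] //;
    [exists Zero|exists Succ|exists Left|exists Right].
rewrite -(subnKC n4) (divn_eq (n - 4) 4).
have : (n - 4) %% 4 < 4 by rewrite ltn_mod.
set q := (n - 4) %/ 4 => r4 lt_n.
have lt_q : q < m.
  apply: leq_trans (_ : _ <= 4 + (q * 4 + (n - 4) %% 4)) lt_n.
  by rewrite -addn1 addnC leq_add // (leq_trans (leq_pmulr q _) (leq_addr _ _)).
rewrite mulnC; have [f Hf] := IHm _ lt_q.
have [f1 Hf1] : exists c, godel c = (nunpair q).1.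
  by apply: IHm; apply: leq_ltn_trans lt_q; rewrite -{2}[q]nunpairK leq_npairl.
have [f2 Hf2] : exists c, godel c = (nunpair q).2.
  by apply: IHm; apply: leq_ltn_trans lt_q; rewrite -{2}[q]nunpairK leq_npairr.
case: (_ %% 4) r4 => [|[|[|[|]]]] // _.
- by exists (Pair f1 f2); rewrite /= Hf1 Hf2 nunpairK addn0.
- by exists (Comp f1 f2); rewrite /= Hf1 Hf2 nunpairK addnA addnAC.
- by exists (Prec f1 f2); rewrite /= Hf1 Hf2 nunpairK addnA addnAC.
- by exists (Mu f); rewrite /= Hf addnA addnAC.
Qed.

(* The intended meaning of judgements is the predicate meaning below. The     *)
(* judgement judg_nonzero c x n, saying that c has nonzero values at <x, m>   *)
(* for m < n, makes the evaluation rule of Mu c finitary.                     *)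
Definition judg_eval c x y := [:: 1; c; x; y].
Definition judg_nonzero c x n := [:: 2; c; x; n].
Definition judg_inv d d' := [:: 3; d; d'].
Definition judg_cat u v w := [:: 4; u; v; w].
Definition judg_eq j u v := [:: 5; j; u; v].
Definition judg_comm j n := [:: 6; j; n].
Definition judg_cyclic j := [:: 7; j].
Definition judg_quotient j := [:: 8; j].

(** Rules 0-10 evaluate programs, 11-14 invert letters, 15-16 concatenate, 17-22 generate [pres_eq],
    23-26 assemble the claim. Rule 20 is congruence under prepending a letter, so cancellation and
    relators are stated only at the front of a word. The [judg_inv] premises of rules 16 and 20
    certify that d is a digit, without which [ncons] would not prepend a letter. *)
Definition rules : seq rule := [::
  (fun a => [:: judg_eval 0 (a 0) 0]);
  (fun a => [:: judg_eval 1 (a 0) (a 0).+1]);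
  (fun a => [:: judg_eval 2 (npair (a 0) (a 1)) (a 0)]);
  (fun a => [:: judg_eval 3 (npair (a 0) (a 1)) (a 1)]);
  (fun a => let: f := a 0 in let: g := a 1 in let: x := a 2 in
    [:: judg_eval (4 + npair f g * 4) x (npair (a 3) (a 4));
        judg_eval f x (a 3); judg_eval g x (a 4)]);
  (fun a => let: f := a 0 in let: g := a 1 in let: x := a 2 in
    [:: judg_eval (5 + npair f g * 4) x (a 4);
        judg_eval g x (a 3); judg_eval f (a 3) (a 4)]);
  (fun a => let: f := a 0 in let: g := a 1 in
    [:: judg_eval (6 + npair f g * 4) (npair (a 2) 0) (a 3);
        judg_eval f (a 2) (a 3)]);
  (fun a => let: f := a 0 in let: g := a 1 in let: x := a 2 in let: n := a 3 in
    [:: judg_eval (6 + npair f g * 4) (npair x n.+1) (a 5);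
        judg_eval (6 + npair f g * 4) (npair x n) (a 4);
        judg_eval g (npair x (npair n (a 4))) (a 5)]);
  (fun a => [:: judg_nonzero (a 0) (a 1) 0]);
  (fun a => let: f := a 0 in let: x := a 1 in let: n := a 2 in
    [:: judg_nonzero f x n.+1;
        judg_nonzero f x n; judg_eval f (npair x n) (a 3).+1]);
  (fun a => let: f := a 0 in let: x := a 1 in let: n := a 2 in
    [:: judg_eval (7 + f * 4) x n;
        judg_nonzero f x n; judg_eval f (npair x n) 0]);
  (fun a => [:: judg_inv 0 1]);
  (fun a => [:: judg_inv 1 0]);
  (fun a => [:: judg_inv 2 3]);
  (fun a => [:: judg_inv 3 2]);
  (fun a => [:: judg_cat 0 (a 0) (a 0)]);
  (fun a => let: d := a 0 in let: u := a 2 in let: v := a 3 in let: w := a 4 in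
    [:: judg_cat (ncons d u) v (ncons d w);
        judg_inv d (a 1); judg_cat u v w]);
  (fun a => [:: judg_eq (a 0) (a 1) (a 1)]);
  (fun a => [:: judg_eq (a 0) (a 2) (a 1); judg_eq (a 0) (a 1) (a 2)]);
  (fun a => [:: judg_eq (a 0) (a 1) (a 3);
        judg_eq (a 0) (a 1) (a 2); judg_eq (a 0) (a 2) (a 3)]);
  (fun a => let: j := a 0 in let: d := a 1 in let: u := a 3 in let: v := a 4 in
    [:: judg_eq j (ncons d u) (ncons d v);
        judg_inv d (a 2); judg_eq j u v]);
  (fun a => let: d := a 1 in let: d' := a 2 in
    [:: judg_eq (a 0) (ncons d (ncons d' (a 3))) (a 3);
        judg_inv d d']);
  (fun a => let: j := a 0 in let: r := a 1 in let: v := a 2 in let: w := a 3 in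
    [:: judg_eq j w v;
        judg_cat r v w; judg_eval j r (a 4)]);
  (fun a => [:: judg_comm (a 0) 0]);
  (fun a => let: j := a 0 in let: n := a 1 in
    [:: judg_comm j n.+1;
        judg_comm j n; judg_eq j (num_ta n) (num_at n)]);
  (fun a => let: j := a 0 in let: n := a 1 in
    [:: judg_cyclic j;
        judg_comm j n.+1; judg_eq j (iter n.+1 (ncons 2) 0) 0]);
  (fun a => let: j := a 0 in
    [:: judg_quotient j;
        judg_cyclic j; judg_eq j (ncons 0 (ncons 0 0)) 0])
].

Lemma computable_rules i : computable (rule_code (nth no_rule rules i)).
Proof.
have Centry k : computable (fun x => entry x k).
  rewrite /entry; apply: computable_fst; apply: computable_iter; computability.
have Cncons d g : computable d -> computable g ->
    computable (fun x => ncons (d x) (g x)).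
  by move=> Cd Cg; rewrite /ncons; computability.
have Cncons1 d : computable (ncons d) by apply: (Cncons); computability.
rewrite /rule_code.
(* One case for each of the 27 rules; the remaining indices give [no_rule]. *)
do 27! [case: i => [|i]; first by rewrite /= /num_at /num_ta;
  do ![progress computability | apply: (Cncons1) | apply: (Cncons)
    | apply: (Centry)]].
by rewrite /= nth_nil /=; computability.
Qed.

(** * Meaning of the judgements and soundness *)

Section Relators.
Variable j : nat.

Definition relators : set (seq (letter 2)) := theta 2 @` W j.

Definition commutes_below (n : nat) : Prop :=
  forall k, k < n -> pres_eq relators (word_ta k) (word_at k).

Definition cyclic_commutes : Prop :=
  exists2 n, commutes_below n.+1 & pres_eq relators (nseq n.+1 gent) [::].

End Relators.

(** A missing premise reads as the zero sequence, with head 0, and so means [True]. *)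
Definition meaning (a : nat -> nat) : Prop :=
  match a 0 with
  | 1 => forall c, godel c = a 1 -> computes c (a 2) (a 3)
  | 2 => forall c, godel c = a 1 ->
      forall m, m < a 3 -> exists k, computes c (npair (a 2) m) k.+1
  | 3 => exists l, digit l = a 1 /\ digit (letter_inv l) = a 2
  | 4 => word_of (a 3) = word_of (a 1) ++ word_of (a 2)
  | 5 => pres_eq (relators (a 1)) (word_of (a 2)) (word_of (a 3))
  | 6 => commutes_below (a 1) (a 2)
  | 7 => cyclic_commutes (a 1)
  | 8 => cyclic_commutes (a 1) /\ pres_eq (relators (a 1)) [:: gena; gena] [::]
  | _ => True
  end.

Lemma rules_sound s : provable rules (encode s) -> meaning (nth 0 s).
Proof.
apply: provable_ind_rule => // i a.
have [F EF] := godel_surj (a 0); have [G EG] := godel_surj (a 1).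
case: i => [|i]; first by move=> _ _ c /(@godel_inj c Zero)->; constructor.
case: i => [|i]; first by move=> _ _ c /(@godel_inj c Succ)->; constructor.
case: i => [|i]; first by move=> _ _ c /(@godel_inj c Left)->; constructor.
case: i => [|i]; first by move=> _ _ c /(@godel_inj c Right)->; constructor.
case: i => [|i].
  rewrite /meaning /= -EF -EG mulnC => Hf Hg c /(@godel_inj c (Pair F G))->.
  by constructor; auto.
case: i => [|i].
  rewrite /meaning /= -EF -EG mulnC => Hg Hf c /(@godel_inj c (Comp F G))->.
  by econstructor; [apply: Hg|apply: Hf].
case: i => [|i].
  rewrite /meaning /= -EF -EG mulnC => Hf _ c /(@godel_inj c (Prec F G))->.
  by constructor; apply: Hf.
case: i => [|i].
  rewrite /meaning /= -EF -EG mulnC => Hp Hg c /(@godel_inj c (Prec F G))->.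
  by econstructor; [apply: Hp|apply: Hg].
case: i => [|i]; first by [].
case: i => [|i].
  rewrite /meaning /= => Hm Hf c Hc m; rewrite ltnS leq_eqVlt => /predU1P[->|].
    by exists (a 3); apply: Hf.
  exact: Hm.
case: i => [|i].
  rewrite /meaning /= -EF mulnC => Hm Hf c /(@godel_inj c (Mu F))->.
  (* The bound moves under the existential so that [choice] yields a total v. *)
  have {}Hm m : exists k, m < a 2 -> computes F (npair (a 1) m) k.+1.
    by case: (ltnP m (a 2)) => [/(Hm F erefl)[k]|_]; [exists k|exists 0].
  have [v Hv] := choice Hm.
  by apply: (@computes_mu _ _ _ v) => //; apply: Hf.
case: i => [|i]; first by exists gena.
case: i => [|i]; first by exists (letter_inv gena).
case: i => [|i]; first by exists gent.
case: i => [|i]; first by exists (letter_inv gent).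
case: i => [|i]; first by rewrite /meaning /= word_of0.
case: i => [|i].
  by rewrite /meaning /= => -[l [<- _]] E; rewrite !word_of_ncons E.
case: i => [|i]; first by move=> _ _; exact: pres_refl.
case: i => [|i]; first by move=> Huv _; exact: pres_sym.
case: i => [|i]; first by move=> Huv Hvw; exact: pres_trans Hvw.
case: i => [|i].
  rewrite /meaning /= => -[l [<- _]] Huv; rewrite !word_of_ncons.
  exact: (@pres_eq_catl _ _ [:: l]).
case: i => [|i].
  rewrite /meaning /= => -[l [<- <-]] _; rewrite !word_of_ncons.
  exact: (@pres_cancel _ _ [::]).
case: i => [|i].
  rewrite /meaning /= => -> Hr; apply: (@pres_relator _ _ [::]).
  have Wr : exists c, godel c = a 0 /\ exists y, computes c (a 1) y.
    by exists F; split=> //; exists (a 4); apply: Hr.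
  by exists (a 1); rewrite ?word_ofE.
case: i => [|i]; first by [].
case: i => [|i].
  rewrite /meaning /= word_of_ta word_of_at => Hc Hn k.
  by rewrite ltnS leq_eqVlt => /predU1P[->|/Hc].
case: i => [|i].
  rewrite /meaning /= -iterS (word_of_iter _ gent) word_of0 cats0.
  by move=> Hc Hn; exists (a 1).
case: i => [|i].
  rewrite /meaning /= => Hc; rewrite !(word_of_ncons gena) word_of0.
  by split.
by rewrite /= nth_nil.
Qed.

(** * Completeness of the rules *)

Section Completeness.

Local Notation holds s := (provable rules (encode s)).

Lemma provable_nil : holds [::].
Proof. exact: derivable0. Qed.

Local Notation by_rule i s := (@provable_rule rules i s).

Lemma provable_eval c x y : computes c x y -> holds (judg_eval (godel c) x y).
Proof.
have D0 := provable_nil.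
elim=> {c x y}.
- by move=> x; apply: (by_rule 0 [:: x]).
- by move=> x; apply: (by_rule 1 [:: x]).
- by move=> a b; apply: (by_rule 2 [:: a; b]).
- by move=> a b; apply: (by_rule 3 [:: a; b]).
- move=> f g x a b _ Df _ Dg; rewrite /= mulnC.
  exact: (by_rule 4 [:: godel f; godel g; x; a; b]).
- move=> f g x y z _ Dg _ Df; rewrite /= mulnC.
  exact: (by_rule 5 [:: godel f; godel g; x; y; z]).
- move=> f g a y _ Df; rewrite /= mulnC.
  exact: (by_rule 6 [:: godel f; godel g; a; y]).
- move=> f g a n y z _ + _ Dg; rewrite /= mulnC => Dp.
  exact: (by_rule 7 [:: godel f; godel g; a; n; y; z]).
move=> f x n v _ Dv _ D; rewrite /= mulnC.
apply: (by_rule 10 [:: godel f; x; n]) => //=.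
(* The infinitary-looking premise of [Mu] is rebuilt one value at a time as a [judg_nonzero]. *)
elim: n Dv {D} => [|n IHn] Dv; first exact: (by_rule 8 [:: godel f; x]).
apply: (by_rule 9 [:: godel f; x; n; v n]); last exact: Dv.
by apply: IHn => m lt_mn; apply: Dv; exact: ltnW.
Qed.

Lemma letter2P (l : letter 2) :
  [\/ l = gena, l = letter_inv gena, l = gent | l = letter_inv gent].
Proof.
case: l => [[[|[|//]] lt_i] b]; rewrite (bool_irrelevance lt_i isT).
  by case: b; [constructor 2|constructor 1].
by case: b; [constructor 4|constructor 3].
Qed.

Lemma provable_inv l : holds (judg_inv (digit l) (digit (letter_inv l))).
Proof.
have D0 := provable_nil.
case: (letter2P l) => ->; rewrite ?letter_invK.
- exact: (by_rule 11 [::]).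
- exact: (by_rule 12 [::]).
- exact: (by_rule 13 [::]).
- exact: (by_rule 14 [::]).
Qed.

Lemma provable_cat (u v : seq (letter 2)) :
  holds (judg_cat (theta_inv u) (theta_inv v) (theta_inv (u ++ v))).
Proof.
have D0 := provable_nil.
elim: u => [|l u IHu]; first exact: (by_rule 15 [:: theta_inv v]).
rewrite cat_cons !theta_inv_cons.
apply: (by_rule 16 [:: digit l; digit (letter_inv l); theta_inv u; theta_inv v;
  theta_inv (u ++ v)]) => //; exact: provable_inv.
Qed.

Lemma provable_cons j l (u v : seq (letter 2)) :
  holds (judg_eq j (theta_inv u) (theta_inv v)) ->
  holds (judg_eq j (theta_inv (l :: u)) (theta_inv (l :: v))).
Proof.
move=> Duv; rewrite !theta_inv_cons.
apply: (by_rule 20 [:: j; digit l; digit (letter_inv l);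
  theta_inv u; theta_inv v]) => //; exact: provable_inv.
Qed.

Lemma provable_catl j (u v w : seq (letter 2)) :
  holds (judg_eq j (theta_inv v) (theta_inv w)) ->
  holds (judg_eq j (theta_inv (u ++ v)) (theta_inv (u ++ w))).
Proof. by move=> Dvw; elim: u => // l u IHu; exact: provable_cons. Qed.

Lemma provable_eq j (u v : seq (letter 2)) : pres_eq (relators j) u v ->
  holds (judg_eq j (theta_inv u) (theta_inv v)).
Proof.
have D0 := provable_nil.
elim=> {u v}.
- by move=> w; exact: (by_rule 17 [:: j; theta_inv w]).
- by move=> v w _ Dvw; exact: (by_rule 18 [:: j; theta_inv v; theta_inv w]).
- move=> u v w _ Duv _ Dvw.
  exact: (by_rule 19 [:: j; theta_inv u; theta_inv v; theta_inv w]).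
- move=> u v l; apply: provable_catl; rewrite !theta_inv_cons.
  apply: (by_rule 21 [:: j; digit l; digit (letter_inv l); theta_inv v]) => //.
  exact: provable_inv.
move=> u v _ [r [c [gc [y cry]]] <-]; apply: provable_catl; rewrite -word_ofE.
apply: (by_rule 22 [:: j; r; theta_inv v; theta_inv (word_of r ++ v); y]).
  by rewrite -{1}[r]word_ofK; exact: provable_cat.
by rewrite /= -gc; exact: provable_eval.
Qed.

Lemma provable_comm j n : commutes_below j n -> holds (judg_comm j n).
Proof.
have D0 := provable_nil.
elim: n => [|n IHn] Hn; first exact: (by_rule 23 [:: j]).
apply: (by_rule 24 [:: j; n]).
  by apply: IHn => k lt_kn; apply: Hn; exact: ltnW.
have := provable_eq (Hn n (ltnSn n)).
by rewrite -word_of_ta -word_of_at !word_ofK.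
Qed.

Lemma provable_quotient j :
  cyclic_commutes j /\ pres_eq (relators j) [:: gena; gena] [::] ->
  holds (judg_quotient j).
Proof.
move=> [[n Hn tn1] aa1].
apply: (by_rule 26 [:: j]); last exact: provable_eq aa1.
apply: (by_rule 25 [:: j; n]); first exact: provable_comm.
by have := provable_eq tn1; rewrite -[nseq _ _]cats0 theta_inv_nseq.
Qed.

End Completeness.

Lemma quotient_semidecidable : exists e, forall j,
  (exists y, computes e j y) <->
  cyclic_commutes j /\ pres_eq (relators j) [:: gena; gena] [::].
Proof.
have Cg : computable (fun j => encode (judg_quotient j)).
  by rewrite /encode /=; computability.
have [e He] := provable_semidecidable computable_rules Cg.
exists e => j; apply: (iff_trans (He j)); split; last exact: provable_quotient.
by move=> /rules_sound.
Qed.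

(** * The lamplighter group *)

Section WordEvaluation.
Local Open Scope group_scope.
Variables (G : groupType) (n : nat) (S : 'I_n -> G).

Lemma word_eval_cons l (w : seq (letter n)) :
  word_eval S (l :: w) = letter_eval S l * word_eval S w.
Proof. by rewrite /word_eval big_cons. Qed.

Lemma word_eval_cat (u v : seq (letter n)) :
  word_eval S (u ++ v) = word_eval S u * word_eval S v.
Proof. by rewrite /word_eval big_cat. Qed.

Lemma word_eval_nseq k l : word_eval S (nseq k l) = letter_eval S l ^+ k.
Proof.
by elim: k => [|k IHk]; rewrite ?expgS -?IHk /word_eval ?big_nil ?big_cons.
Qed.

Lemma letter_eval_inv l : letter_eval S (letter_inv l) = (letter_eval S l)^-1.
Proof. by case: l => i []; rewrite /letter_eval /= ?invgK. Qed.

Lemma word_eval_inv (w : seq (letter n)) :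
  word_eval S (word_inv w) = (word_eval S w)^-1.
Proof.
elim: w => [|l w IHw]; first by rewrite /word_eval big_nil invg1.
rewrite /word_inv /= rev_cons -/(word_inv w) -cats1 word_eval_cat IHw.
by rewrite !word_eval_cons letter_eval_inv invgM /word_eval big_nil mulg1.
Qed.

End WordEvaluation.

(** * The relations, and their reduction when t has finite order *)

Section LamplighterRelations.
Local Open Scope group_scope.
Variables (H : groupType) (S : 'I_2 -> H).
Let a := letter_eval S gena.
Let t := letter_eval S gent.

Lemma word_eval_ta k : word_eval S (word_ta k) = t ^+ k * a * t ^- k * a.
Proof.
rewrite word_eval_cat word_eval_cons word_eval_cat !word_eval_nseq.
by rewrite letter_eval_inv /word_eval big_seq1 expVgn !mulgA.
Qed.

Lemma word_eval_at k : word_eval S (word_at k) = a * (t ^+ k * a * t ^- k).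
Proof.
rewrite word_eval_cons word_eval_cat word_eval_cons !word_eval_nseq.
by rewrite letter_eval_inv expVgn !mulgA.
Qed.

Lemma word_eval_commute k :
  word_eval S (word_ta k) = word_eval S (word_at k) <->
  commute (t ^+ k * a * t ^- k) a.
Proof. by rewrite word_eval_ta word_eval_at. Qed.

Lemma commute_cyclic n : t ^+ n.+1 = 1 ->
  (forall k, k < n.+1 -> commute (t ^+ k * a * t ^- k) a) ->
  forall k, commute (t ^+ k * a * t ^- k) a.
Proof.
move=> tn1 Hn k; have -> : t ^+ k = t ^+ (k %% n.+1).
  by rewrite {1}(divn_eq k n.+1) expgnDr mulnC expgnA tn1 expg1n mul1g.
by apply: Hn; rewrite ltn_mod.
Qed.

(** Pigeonhole on the powers of x with exponents 0 to |X|: two equal ones, at i < k, give x^(k-i) =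
    1. *)
Lemma finite_group_exponent (x : H) : finite_group H -> exists n, x ^+ n.+1 = 1.
Proof.
move=> /finite_fsetP[X HX].
have : ~~ uniq [seq x ^+ k | k <- iota 0 (#|` X |%fset).+1].
  apply/negP => Hu.
  have : {subset [seq x ^+ k | k <- iota 0 (#|` X |%fset).+1] <= X}.
    by move=> y _; have : [set: H]%classic y by []; rewrite HX.
  by move=> /(uniq_leq_size Hu); rewrite size_map size_iota ltnn.
move=> /(uniqPn 1)[i [k []]]; rewrite size_map size_iota => lt_ik lt_k.
rewrite !(nth_map 0) ?size_iota ?(ltn_trans lt_ik) //.
rewrite !nth_iota ?(ltn_trans lt_ik) //.
rewrite !add0n => E; exists (k - i).-1; rewrite prednK ?subn_gt0 //.
by rewrite expgnFr ?(ltnW lt_ik) // -E mulgV.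
Qed.

End LamplighterRelations.

(** * The standard marking of the lamplighter group *)

Section Lamplighter.
Local Open Scope group_scope.

Local Notation A := (mult_group 'Z_2).
Local Notation B := (mult_group int).
Local Notation L := (wreath A B).

Definition lit : A := (1 : 'Z_2)%R.
Definition one_step : B := (1 : int)%R.

Definition lamp (b : B) : {fsfun B -> A with 1} :=
  [fsfun x in [fset b]%fset => lit | 1].
Definition no_lamp : {fsfun B -> A with 1} := [fsfun with 1].

Definition lampmark (i : 'I_2) : L :=
  if i == 0 :> nat then (lamp 1, 1) else (no_lamp, one_step).

Lemma lampE b x : lamp b x = if x == b then lit else 1.
Proof. by rewrite fsfunE in_fset1. Qed.

Lemma lit_sq : lit * lit = 1.
Proof. exact: val_inj. Qed.

Lemma not_litP (x : A) : x != 1 -> x = lit.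
Proof. by case: x => [[|[|//]] lt_x] // _; apply: val_inj. Qed.

Lemma lampC (x y : A) : x * y = y * x.
Proof. exact: (@addrC 'Z_2). Qed.

Lemma step_ind (P : B -> Prop) : P 1 -> (forall b, P b -> P (one_step * b)) ->
  (forall b, P b -> P (one_step^-1 * b)) -> forall b, P b.
Proof.
move=> P0 PS PV; elim/int_ind => [|n IHn|n IHn]; first exact: P0.
  by rewrite -add1n PoszD; exact: (PS n IHn).
by rewrite -add1n PoszD opprD; exact: (PV _ IHn).
Qed.

(** Lamps have two states, so multiplying by [lamp b] adds b to the support or removes it; equality
    is up to the order of enumeration. *)
Lemma finsupp_toggle b (f g : {fsfun B -> A with 1}) :
  (forall x, g x = lamp b x * f x) ->
  if b \in finsupp f then perm_eq (finsupp f) (b :: finsupp g)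
  else perm_eq (finsupp g) (b :: finsupp f).
Proof.
move=> gE; have gN x : x != b -> g x = f x.
  by rewrite gE lampE => /negbTE->; rewrite mul1g.
have gb : g b = lit * f b by rewrite gE lampE eqxx.
rewrite mem_finsupp; case: ifPn => [/not_litP fb|/negPn/eqP fb].
  have bg : b \notin finsupp g by rewrite mem_finsupp gb fb lit_sq eqxx.
  apply: uniq_perm => [||x]; rewrite /= ?bg ?fset_uniq // inE.
  have [->|xb] := eqVneq x b; first by rewrite mem_finsupp fb.
  by rewrite !mem_finsupp gN.
have bf : b \notin finsupp f by rewrite mem_finsupp fb eqxx.
apply: uniq_perm => [||x]; rewrite /= ?bf ?fset_uniq // inE.
have [->|xb] := eqVneq x b; first by rewrite mem_finsupp gb fb mulg1.
by rewrite !mem_finsupp gN.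
Qed.

Lemma wreathM (x y : L) :
  x * y = (fsfun_mul x.1 (fsfun_shift x.2 y.1), x.2 * y.2).
Proof. by []. Qed.

Lemma lampmark_a : letter_eval lampmark gena = (lamp 1, 1).
Proof. by []. Qed.

Lemma lampmark_t : letter_eval lampmark gent = (no_lamp, one_step).
Proof. by []. Qed.

Lemma fsfun_shift1 f : fsfun_shift (1 : B) f = f :> {fsfun B -> A with 1}.
Proof. by apply/fsfunP => x; rewrite fsfun_shiftE invg1 mul1g. Qed.

Lemma fsfun_mul0 f : fsfun_mul no_lamp f = f.
Proof. by apply/fsfunP => x; rewrite fsfun_mulE fsfun0E mul1g. Qed.

(** Shifts are powers of t, the single lamp at b is a conjugated by the shift by b, and a general
    configuration is reached by induction on the number of lit lamps. *)
Lemma lampmark_generates : generates lampmark.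
Proof.
have fE := (fsfun_mulE, fsfun_shiftE, fsfun_invE, @fsfun0E).
pose R (x : L) := exists w, word_eval lampmark w = x.
have RM x y : R x -> R y -> R (x * y).
  by move=> [u <-] [v <-]; exists (u ++ v); rewrite word_eval_cat.
have RV x : R x -> R x^-1.
  by move=> [u <-]; exists (word_inv u); rewrite word_eval_inv.
have R1 : R 1 by exists [::]; rewrite /word_eval big_nil.
have Rl l : R (letter_eval lampmark l).
  by exists [:: l]; rewrite /word_eval big_seq1.
have Rt (b : B) : R (no_lamp, b).
  elim/step_ind: b => [|b Rb|b Rb]; first exact: R1.
    have := RM _ _ (Rl gent) Rb; congr R; rewrite lampmark_t wreathM /=.
    rewrite fsfun_mul0; congr pair; apply/fsfunP => x.
    by rewrite fsfun_shiftE !fsfun0E.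
  have := RM _ _ (RV _ (Rl gent)) Rb; congr R; rewrite lampmark_t wreathM /=.
  by congr pair; apply/fsfunP => x; rewrite !fE invg1 mul1g.
have Ra (b : B) : R (lamp b, 1).
  have := RM _ _ (RM _ _ (Rt b) (Rl gena)) (RV _ (Rt b)).
  congr R; rewrite lampmark_a !wreathM /= mulg1 mulgV; congr pair.
  apply/fsfunP => x; rewrite !(fE, lampE) invg1 mul1g mulg1.
  congr (if _ then _ else _).
  by rewrite (can2_eq (mulVKg b) (mulKg b)) mulg1.
move=> [f b]; rewrite -/(R _).
have -> : (f, b) = ((f, 1) : L) * ((no_lamp, b) : L).
  rewrite wreathM /= fsfun_shift1 mul1g; congr pair; apply/fsfunP => x.
  by rewrite fsfun_mulE fsfun0E mulg1.
apply: (RM _ _ _ (Rt b)) => {b}.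
have [n] := ubnP (size (finsupp f)); elim: n f => // n IHn f lt_f.
have [f0|[b bf]] := fset_0Vmem (finsupp f).
  have -> : f = no_lamp; last exact: Rt.
  by apply/fsfunP => x; rewrite fsfun0E fsfun_dflt // f0 in_fset0.
have := finsupp_toggle (fsfun_mulE (lamp b) f); rewrite bf => /perm_size /= E.
have -> : (f, 1) = ((lamp b, 1) : L) * ((fsfun_mul (lamp b) f, 1) : L).
  rewrite wreathM /= mulg1 fsfun_shift1; congr pair; apply/fsfunP => x.
  rewrite !fsfun_mulE mulgA lampE; case: ifP => _; last by rewrite !mul1g.
  by rewrite lit_sq mul1g.
by apply: RM (Ra b) _; apply: IHn; rewrite E in lt_f.
Qed.

Lemma commute_base (x y : L) : x.2 = 1 -> y.2 = 1 -> commute x y.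
Proof.
case: x y => f b [g c] /= -> ->; rewrite /commute !wreathM /= !fsfun_shift1.
by congr pair; apply/fsfunP => x; rewrite !fsfun_mulE lampC.
Qed.

Lemma lampmark_sq :
  letter_eval lampmark gena * letter_eval lampmark gena = 1.
Proof.
rewrite lampmark_a wreathM /= fsfun_shift1 mulg1; congr pair; apply/fsfunP => x.
by rewrite fsfun_mulE fsfun0E lampE; case: ifP => _; rewrite ?lit_sq ?mulg1.
Qed.

Lemma lampmark_commute k : let t := letter_eval lampmark gent in
  let a := letter_eval lampmark gena in commute (t ^+ k * a * t ^- k) a.
Proof.
move=> t a; apply: commute_base => //.
have M x y : (x * y : L).2 = x.2 * y.2 by [].
have V x : (x^-1 : L).2 = x.2^-1 by [].
by rewrite !M V mulg1 mulgV.
Qed.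

(** * The morphism defined by a pair satisfying the relations *)

Section Universal.
Variables (H : groupType) (a t : H).
Hypothesis a_sq : a * a = 1.
Hypothesis a_comm : forall k, commute (t ^+ k * a * t ^- k) a.

(** The integer power t^b. *)
Definition stepX (b : B) : H :=
  match (b : int) with Posz n => t ^+ n | Negz n => t ^- n.+1 end.

Lemma stepX1 : stepX 1 = 1.
Proof. by []. Qed.

Lemma stepXS b : stepX (one_step * b) = t * stepX b.
Proof.
case: b => [n|n]; first by rewrite /= -expgS.
case: n => [|n]; first by rewrite /stepX /= mulgV.
have -> : one_step * (Negz n.+1 : B) = (Negz n : B).
  change (1 + Negz n.+1 = Negz n)%R.
  by rewrite !NegzE -[n.+2]add1n PoszD opprD addrA subrr add0r.
by rewrite /stepX (expgSr _ n.+1) invgM mulVKg.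
Qed.

Lemma stepXD b c : stepX (b * c) = stepX b * stepX c.
Proof.
elim/step_ind: b => [|b IHb|b IHb]; first by rewrite mul1g stepX1 mul1g.
  by rewrite -mulgA !stepXS IHb mulgA.
apply: (mulgI t); rewrite -stepXS -!mulgA mulVKg IHb mulgA -stepXS.
by rewrite mulVKg.
Qed.

(** The intended image of the single lamp at b. *)
Definition conj_step (b : B) : H := stepX b * a * (stepX b)^-1.

Lemma conj_stepD b c : conj_step (b * c) = stepX b * conj_step c * (stepX b)^-1.
Proof. by rewrite /conj_step stepXD invgM !mulgA. Qed.

Lemma conj_step_sq b : conj_step b * conj_step b = 1.
Proof.
by rewrite /conj_step -!mulgA mulKg (mulgA a) a_sq mul1g mulgV.
Qed.

Lemma commute_conj (x y z : H) :
  commute y z -> commute (x * y * x^-1) (x * z * x^-1).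
Proof.
move=> yz; rewrite /commute -!mulgA !mulKg; congr (_ * _).
by rewrite !mulgA yz.
Qed.

(** Conjugating by t^b reduces to a and t^d a t^-d with d = c - b. For d >= 0 this is the
    hypothesis; for d < 0 it is the hypothesis for -d conjugated by t^d. *)
Lemma conj_step_commute b c : commute (conj_step b) (conj_step c).
Proof.
suff base d : commute a (conj_step d).
  rewrite -[c](mulVKg b) -{1}[b]mulg1.
  rewrite (conj_stepD b 1) (conj_stepD b (b^-1 * c)).
  apply: commute_conj; rewrite {1}/conj_step stepX1 mul1g invg1 mulg1.
  exact: base.
case: d => n; first exact: commute_sym (a_comm n).
have := commute_conj (t ^- n.+1) (a_comm n.+1).
by rewrite /conj_step /stepX invgK !mulgA mulVg mul1g mulgVK.
Qed.

Definition lamps (s : seq B) : H := \prod_(b <- s) conj_step b.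

Lemma lamps_perm s1 s2 : perm_eq s1 s2 -> lamps s1 = lamps s2.
Proof.
move=> s12; pattern s2; apply: (catCA_perm_ind _ s12) => // u v w ->.
rewrite /lamps !big_cat /= !mulgA; congr (_ * _).
apply: commute_prod => c _; apply/commute_sym/commute_prod => b _.
exact: conj_step_commute.
Qed.

(** A lit lamp has only one possible value, so the support determines the configuration; by
    [lamps_perm] the order of enumeration is irrelevant. *)
Definition lampmor (x : L) : H := lamps (finsupp x.1) * stepX x.2.

Lemma lamps_map s : lamps [seq one_step * b | b <- s] = t * lamps s * t^-1.
Proof.
rewrite /lamps big_map; elim: s => [|b s IHs].
  by rewrite !big_nil mulg1 mulgV.
rewrite !big_cons IHs conj_stepD -[one_step]mulg1 stepXS stepX1 mulg1.
by rewrite !mulgA mulgVK.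
Qed.

(** The lamp at the origin is toggled; if it was lit, its factor cancels against a because a^2 =
    1. *)
Lemma lampmor_a x : lampmor (letter_eval lampmark gena * x) = a * lampmor x.
Proof.
rewrite lampmark_a wreathM /lampmor /= fsfun_shift1 mul1g mulgA; congr (_ * _).
have aE : conj_step 1 = a by rewrite /conj_step stepX1 mul1g invg1 mulg1.
rewrite -aE; have := finsupp_toggle (fsfun_mulE (lamp 1) x.1).
have lamps_cons b s : lamps (b :: s) = conj_step b * lamps s.
  by rewrite /lamps big_cons.
case: ifP => _ /lamps_perm ->; rewrite lamps_cons //.
by rewrite mulgA conj_step_sq mul1g.
Qed.

(** Translating the support by one step conjugates the product of lamps by t. *)
Lemma lampmor_t x : lampmor (letter_eval lampmark gent * x) = t * lampmor x.
Proof.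
rewrite lampmark_t wreathM /lampmor /= fsfun_mul0 stepXS.
have /lamps_perm-> : perm_eq (finsupp (fsfun_shift one_step x.1))
    [seq one_step * b | b <- finsupp x.1].
  apply: uniq_perm => [||y]; first exact: fset_uniq.
    by rewrite (map_inj_uniq (@mulgI _ one_step)) fset_uniq.
  rewrite -[y](mulVKg one_step) (mem_map (@mulgI _ one_step)).
  by rewrite !mem_finsupp fsfun_shiftE mulKg.
by rewrite lamps_map !mulgA mulgVK.
Qed.

End Universal.

(** Reduces multiplicativity of [lampmor] to that of [word_eval], so that only left multiplication
    by the two generators has to be computed. *)
Lemma lampmor_word (H : groupType) (S : 'I_2 -> H) :
  let a := letter_eval S gena in let t := letter_eval S gent in
  a * a = 1 -> (forall k, commute (t ^+ k * a * t ^- k) a) ->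
  forall w, lampmor a t (word_eval lampmark w) = word_eval S w.
Proof.
move=> a t aa ac; elim=> [|l w IHw].
  by rewrite /word_eval !big_nil /lampmor /lamps finsupp0 big_seq_fset0 mulg1.
rewrite !word_eval_cons -IHw.
case: (letter2P l) => ->; rewrite ?letter_eval_inv.
- exact: lampmor_a.
- by apply: (mulgI a); rewrite -lampmor_a // !mulVKg.
- exact: lampmor_t.
- by apply: (mulgI t); rewrite -lampmor_t // !mulVKg.
Qed.

Definition lamplighter_marked : markedGroup 2 :=
  @MarkedGroup 2 lamplighter _ lampmark_generates.

Lemma lamplighter_quotientP (H : markedGroup 2) :
  let a := letter_eval (mark H) gena in let t := letter_eval (mark H) gent in
  marked_quotient lamplighter_marked H <->
  a * a = 1 /\ forall k, commute (t ^+ k * a * t ^- k) a.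
Proof.
move=> a t; split=> [[f fm]|[aa ac]].
  have fa : f (letter_eval lampmark gena) = a by exact: (fm gena.1).
  have ft : f (letter_eval lampmark gent) = t by exact: (fm gent.1).
  have f1 : f 1 = 1 by apply: (mulgI (f 1)); rewrite -gmulfM !mulg1.
  have fV x : f x^-1 = (f x)^-1.
    by apply: (mulgI (f x)); rewrite -gmulfM !mulgV.
  have fX x k : f (x ^+ k) = f x ^+ k.
    by elim: k => // k IHk; rewrite !expgS gmulfM IHk.
  split=> [|k]; first by rewrite -fa -gmulfM lampmark_sq.
  rewrite -fa -ft -fX -fV -!gmulfM /commute -!gmulfM; congr (f _).
  exact: lampmark_commute.
have fw := lampmor_word aa ac.
have fM : {morph lampmor a t : x y / x * y}.
  move=> x y; have [u <-] := lampmark_generates x.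
  have [v <-] := lampmark_generates y.
  by rewrite -word_eval_cat !fw word_eval_cat.
pose f : {multiplicative lamplighter -> H} :=
  HB.pack (lampmor a t) (isMultiplicative.Build _ _ (lampmor a t) fM).
exists f => i; have := fw [:: (i, false)].
by rewrite /word_eval !big_seq1.
Qed.

End Lamplighter.

(** * Finite quotients and the algorithm *)

Lemma nuRP_quotientP j : finite_group (nuRP 2 j) ->
  marked_quotient lamplighter_marked (nuRP 2 j) <->
  cyclic_commutes j /\ pres_eq (relators j) [:: gena; gena] [::].
Proof.
move=> finH; pose S := mark (nuRP 2 j).
have eqE u v : pres_eq (relators j) u v <-> word_eval S u = word_eval S v.
  by rewrite /S /= !pres_word_eval; apply: iff_sym; exact: pres_classP.
apply: (iff_trans (lamplighter_quotientP _)); rewrite -/S.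
split=> [[aa ac]|[[n Hn /eqE tn1] /eqE aa]]; split.
(* Finiteness supplies the n that [cyclic_commutes] asks for. *)
- have [n tn1] := finite_group_exponent (letter_eval S gent) finH.
  exists n; first by move=> k _; apply/eqE/word_eval_commute.
  by apply/eqE; rewrite word_eval_nseq tn1 /word_eval big_nil.
- by apply/eqE; rewrite /word_eval big_nil big_cons big_seq1.
- by move: aa; rewrite /word_eval big_nil big_cons big_seq1.
apply: (@commute_cyclic _ S n) => [|k lt_k].
  by move: tn1; rewrite word_eval_nseq /word_eval big_nil.
by apply/word_eval_commute/eqE/Hn.
Qed.

Theorem proposition54 :
  group_has_marked_quotient_algorithm finite_group lamplighter.
Proof.
have [e He] := quotient_semidecidable.
have [F CF FE] := code_partial_computable e.
exists 2, lampmark, lampmark_generates, F; split=> // j finH.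
exact: iff_trans (FE j) (iff_trans (He j) (iff_sym (nuRP_quotientP finH))).
Qed.
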